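(* Let $\{\mu_i(x):i\in[n]\}$ and $\{\mu_j(y):j\in[n]\}$ be two blending basis sequences on $[0,1]$, let $\{x_h\}_{h=0}^m\subseteq[0,1]$ and $\{y_l\}_{l=0}^p\subseteq[0,1]$ be real increasing sequences, and let $A=[\mu_i(x_h)]_{h=0,i=0}^{m,n}\in\mathbb{R}^{(m+1)\times(n+1)}$ and $B^T=[\mu_j(y_l)]_{l=0,j=0}^{p,n}\in\mathbb{R}^{(p+1)\times(n+1)}$ be the corresponding collocation matrices. Suppose that $A$ and $B^T$ have full column rank and that the number $(m+1)(p+1)$ of data points $Q_{hl}\in\mathbb{R}^3$ ($h\in[m]$, $l\in[p]$) is larger than the number $(n+1)^2$ of control points. Let $\{\mathrm{I}_i\}_{i=0}^{\imath}$ and $\{\mathrm{J}_j\}_{j=0}^{\jmath}$ be any two partitions of $[n]$, let $P_{ij}^{(0)}\in\mathbb{R}^3$ ($i,j\in[n]$) be any initial control points, and let $S^{(k)}(x,y)=\sum_{i=0}^n\sum_{j=0}^n\mu_i(x)\mu_j(y)P_{ij}^{(k)}$, $k=0,1,2,\dots$, be the fitting surfaces generated by the randomized progressive iterative approximation (RPIA) for surfaces. Then the sequence of fitting surfaces converges in expectation to the least-squares fitting solution of the data points; that is, if $(P_{ij}^* )_{i,j\in[n]}$ denotes the least-squares control points, then $$\lim_{k\to\infty}\mathbb{E}\big[P_{ij}^{(k)}\big]=P_{ij}^*\quad\text{for all } i,j\in[n],$$ so that $\lim_{k\to\infty}\mathbb{E}[S^{(k)}(x,y)]=\sum_{i=0}^n\sum_{j=0}^n\mu_i(x)\mu_j(y)P_{ij}^*$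 for every $x\in[x_0,x_m]$, $y\in[y_0,y_p]$.
   Context: Notation: $[\ell]=\{0,1,\dots,\ell\}$. A blending basis sequence is a finite sequence of real-valued basis functions $\mu_0,\dots,\mu_n$ on $[0,1]$ (for example, B-splines); no further property of it is specified. The data points are $Q_{hl}\in\mathbb{R}^3$, with $Q_{hl}$ attached to the parameter pair $(x_h,y_l)$. A partition $\{\mathrm{I}_i\}_{i=0}^{\imath}$ of $[n]$ is a family of (nonempty) pairwise disjoint subsets with union $[n]$; likewise for $\{\mathrm{J}_j\}_{j=0}^{\jmath}$. Least-squares fitting solution: the control points $(P_{ij}^* )$ minimizing $\sum_{h=0}^m\sum_{l=0}^p\|Q_{hl}-\sum_{i=0}^n\sum_{j=0}^n\mu_i(x_h)\mu_j(y_l)P_{ij}\|^2$. Equivalently, for each coordinate $t=1,2,3$, with $Q_{(t)}\in\mathbb{R}^{(m+1)\times(p+1)}$ and $P_{(t)}^*\in\mathbb{R}^{(n+1)\times(n+1)}$ the matrices of $t$-th coordinates of the $Q_{hl}$ and $P_{ij}^*$, one has $P_{(t)}^*=(A^TA)^{-1}A^TQ_{(t)}B^T(BB^T)^{-1}$ when $A$ and $B^T$ have full column rank. The least-squares fitting surface is $\sum_{i,j}\mu_i(x)\mu_j(y)P_{ij}^*$. RPIA for surfaces: the initial control points $P_{ij}^{(0)}$ are given (deterministic). For $k=0,1,2,\dots$: (1) Form $S^{(k)}(x,y)=\sum_{i=0}^n\sum_{j=0}^n\mu_i(x)\mu_j(y)P_{ij}^{(k)}$ and the differences $R_{hl}^{(k)}=Q_{hl}-S^{(k)}(x_h,y_l)$,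 $h\in[m]$, $l\in[p]$. (2) Choose random indices $\imath_k\in[\imath]$ and $\jmath_k\in[\jmath]$, independently of each other and of all previous choices, with $$\mathrm{P}(\imath_k=s)=\frac{\sum_{i\in\mathrm{I}_s}\sum_{h=0}^m\mu_i^2(x_h)}{\sum_{i=0}^n\sum_{h=0}^m\mu_i^2(x_h)},\qquad \mathrm{P}(\jmath_k=s)=\frac{\sum_{j\in\mathrm{J}_s}\sum_{l=0}^p\mu_j^2(y_l)}{\sum_{j=0}^n\sum_{l=0}^p\mu_j^2(y_l)}.$$ (3) For $i\in\mathrm{I}_{\imath_k}$ and $j\in\mathrm{J}_{\jmath_k}$ set $$\Delta_{ij}^{(k)}=\frac{\sum_{h=0}^m\sum_{l=0}^p\mu_i(x_h)\mu_j(y_l)R_{hl}^{(k)}}{\Big(\sum_{i'\in\mathrm{I}_{\imath_k}}\sum_{h=0}^m\mu_{i'}^2(x_h)\Big)\Big(\sum_{j'\in\mathrm{J}_{\jmath_k}}\sum_{l=0}^p\mu_{j'}^2(y_l)\Big)},$$ and set $\Delta_{ij}^{(k)}=0$ for all other $(i,j)$. (4) Set $P_{ij}^{(k+1)}=P_{ij}^{(k)}+\Delta_{ij}^{(k)}$ for all $i,j\in[n]$. The expectation $\mathbb{E}$ is over the random choices $\imath_0,\jmath_0,\imath_1,\jmath_1,\dots$. *)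

(* Defs.v *)
From HB Require Import structures.
From mathcomp Require Import all_boot all_order all_algebra.
From mathcomp Require Import all_classical all_reals all_analysis.

Set Implicit Arguments.
Unset Strict Implicit.
Unset Printing Implicit Defensive.

Import Order.TTheory GRing.Theory Num.Theory.
Local Open Scope classical_set_scope.
Local Open Scope ring_scope.

(* The interval [n] = {0, ..., n} is 'I_n.+1.  Basis functions are total
   functions on R; they are only ever evaluated at points of [0, 1]. *)
Definition collocation (R : realType) (n m : nat)
    (mu : 'I_n.+1 -> R -> R) (x : 'I_m.+1 -> R) : 'M[R]_(m.+1, n.+1) :=
  \matrix_(h < m.+1, i < n.+1) mu i (x h).

Definition net (R : realType) (n : nat) : Type :=
  'I_n.+1 -> 'I_n.+1 -> 'rV[R]_3.

Definition surface (R : realType) (n : nat) (mu nu : 'I_n.+1 -> R -> R)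
    (P : net R n) (u v : R) : 'rV[R]_3 :=
  \sum_(i < n.+1) \sum_(j < n.+1) (mu i u * nu j v) *: P i j.

Definition residual (R : realType) (n m p : nat) (mu nu : 'I_n.+1 -> R -> R)
    (x : 'I_m.+1 -> R) (y : 'I_p.+1 -> R)
    (Q : 'I_m.+1 -> 'I_p.+1 -> 'rV[R]_3) (P : net R n)
    (h : 'I_m.+1) (l : 'I_p.+1) : 'rV[R]_3 :=
  Q h l - surface mu nu P (x h) (y l).

(* Euclidean; the library norm on row vectors is the sup norm. *)
Definition sqnorm (R : realType) (v : 'rV[R]_3) : R :=
  \sum_(t < 3) v ord0 t ^+ 2.

Definition fitting_error (R : realType) (n m p : nat)
    (mu nu : 'I_n.+1 -> R -> R) (x : 'I_m.+1 -> R) (y : 'I_p.+1 -> R)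
    (Q : 'I_m.+1 -> 'I_p.+1 -> 'rV[R]_3) (P : net R n) : R :=
  \sum_(h < m.+1) \sum_(l < p.+1) sqnorm (residual mu nu x y Q P h l).

Definition least_squares (R : realType) (n m p : nat)
    (mu nu : 'I_n.+1 -> R -> R) (x : 'I_m.+1 -> R) (y : 'I_p.+1 -> R)
    (Q : 'I_m.+1 -> 'I_p.+1 -> 'rV[R]_3) (Pstar : net R n) : Prop :=
  forall P : net R n,
    fitting_error mu nu x y Q Pstar <= fitting_error mu nu x y Q P.

Definition block_partition (n a : nat) (I : 'I_a.+1 -> {set 'I_n.+1}) : Prop :=
  [/\ forall s : 'I_a.+1, I s != finset.set0,
      forall s t : 'I_a.+1, s != t -> (I s :&: I t)%SET = finset.set0 &
      (\bigcup_(s < a.+1) I s)%SET = [set: 'I_n.+1]%SET ].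

Definition block_weight (R : realType) (n m : nat)
    (mu : 'I_n.+1 -> R -> R) (x : 'I_m.+1 -> R) (D : {set 'I_n.+1}) : R :=
  \sum_(i in D) \sum_(h < m.+1) mu i (x h) ^+ 2.

Definition adjustment (R : realType) (n m p : nat)
    (mu nu : 'I_n.+1 -> R -> R) (x : 'I_m.+1 -> R) (y : 'I_p.+1 -> R)
    (Q : 'I_m.+1 -> 'I_p.+1 -> 'rV[R]_3) (Di Dj : {set 'I_n.+1})
    (P : net R n) : net R n :=
  fun i j =>
    if (i \in Di) && (j \in Dj) then
      (block_weight mu x Di * block_weight nu y Dj)^-1 *:
        \sum_(h < m.+1) \sum_(l < p.+1)
          (mu i (x h) * nu j (y l)) *: residual mu nu x y Q P h l
    else 0.

(* [si k] and [sj k] are the blocks selected at step [k]. *)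
Fixpoint rpia (R : realType) (n m p a b : nat)
    (mu nu : 'I_n.+1 -> R -> R) (x : 'I_m.+1 -> R) (y : 'I_p.+1 -> R)
    (Q : 'I_m.+1 -> 'I_p.+1 -> 'rV[R]_3)
    (I : 'I_a.+1 -> {set 'I_n.+1}) (J : 'I_b.+1 -> {set 'I_n.+1})
    (P0 : net R n) (si : nat -> 'I_a.+1) (sj : nat -> 'I_b.+1)
    (k : nat) : net R n :=
  if k is k'.+1 then
    let P := rpia mu nu x y Q I J P0 si sj k' in
    fun i j => P i j + adjustment mu nu x y Q (I (si k')) (J (sj k')) P i j
  else P0.

(* The family of events generated by X, for the discrete sigma-algebra on V. *)
Definition events_of (T V : Type) (X : T -> V) : set (set T) :=
  [set X @^-1` B | B in [set: set V]].

Definition mutually_independent (d : measure_display) (T : measurableType d)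
    (R : realType) (Pr : probability T R) (K : eqType)
    (F : K -> set (set T)) : Prop :=
  forall (s : seq K) (E : K -> set T),
    uniq s -> (forall k, k \in s -> F k (E k)) ->
    Pr (\bigcap_(k in [set` s]) E k) = (\prod_(k <- s) Pr (E k))%E.

Definition block_law (d : measure_display) (T : measurableType d)
    (R : realType) (Pr : probability T R) (n m a : nat)
    (mu : 'I_n.+1 -> R -> R) (x : 'I_m.+1 -> R)
    (I : 'I_a.+1 -> {set 'I_n.+1}) (X : T -> 'I_a.+1) : Prop :=
  forall s : 'I_a.+1,
    Pr (X @^-1` [set s]) =
    (block_weight mu x (I s) /
     (\sum_(i < n.+1) \sum_(h < m.+1) mu i (x h) ^+ 2))%:E.

(* Index [inl k] stands for the row choice and [inr k] for the column choice
   made at step [k]. *)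
Definition rpia_choices (d : measure_display) (T : measurableType d)
    (R : realType) (Pr : probability T R) (n m p a b : nat)
    (mu nu : 'I_n.+1 -> R -> R) (x : 'I_m.+1 -> R) (y : 'I_p.+1 -> R)
    (I : 'I_a.+1 -> {set 'I_n.+1}) (J : 'I_b.+1 -> {set 'I_n.+1})
    (si : nat -> T -> 'I_a.+1) (sj : nat -> T -> 'I_b.+1) : Prop :=
  [/\ forall k, events_of (si k) `<=` measurable,
      forall k, events_of (sj k) `<=` measurable,
      mutually_independent Pr (fun c : nat + nat =>
        match c with inl k => events_of (si k) | inr k => events_of (sj k) end),
      forall k, block_law Pr mu x I (si k) &
      forall k, block_law Pr nu y J (sj k) ].

(* Main.v *)
Require Import Defs.
From HB Require Import structures.
From mathcomp Require Import all_boot all_order all_algebra.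
From mathcomp Require Import all_classical all_reals all_analysis.
From mathcomp Require Import ring lra.
Import Order.TTheory GRing.Theory Num.Theory.
Import numFieldNormedType.Exports.
Local Open Scope classical_set_scope.
Local Open Scope ring_scope.
Set Implicit Arguments.
Unset Strict Implicit.

(** Work with one coordinate at a time, so that control points and data become
    matrices P and Q and the surface sampled on the grid is A P B.  The numerator
    of the adjustment is then the entry (i, j) of the gradient
    G = A^T (Q - A P B) B^T.  A block pair is drawn with a probability
    proportional to the product of its two weights, and the adjustment is
    divided by that same product.  Each entry lies in exactly one block pair, so
    the two factors cancel and the conditional mean of one step is the full
    gradient step P + c G, with c = 1 / (|A|^2 |B|^2) in Frobenius norm
    ([mean_step]).

    At a least-squares net the gradient vanishes ([normal_equations]), hence the
    mean error E evolves by the deterministic linear map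
    E |-> E - c A^T (A E B) B^T.  Expanding the square and bounding
    |A^T X B^T|^2 by |A|^2 |B|^2 |X|^2 shows that |E|^2 loses at least
    c |A E B|^2.  Full column rank gives one-sided inverses of A and B, so
    |A E B|^2 dominates a multiple of |E|^2 and the map is a strict contraction
    ([error_map_contraction]).  The mean error therefore decays geometrically,
    with no recourse to spectral theory.

    The expectation itself is a finite sum: k steps only see the first k pairs
    of choices, whose joint law is a product by independence ([history_law]).
    Conditioning on the past becomes the recursion [path_meanS] for these
    sums. *)

(** * Frobenius norm and gradient steps *)

(** The square of the Frobenius norm. *)
Definition frob (R : realFieldType) m n (M : 'M[R]_(m, n)) : R := \tr (M^T *m M).

Lemma frobE (R : realFieldType) m n (M : 'M[R]_(m, n)) :
  frob M = \sum_i \sum_j M i j ^+ 2.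
Proof.
rewrite exchange_big; apply: eq_bigr => j _; rewrite mxE.
by apply: eq_bigr => i _; rewrite mxE expr2.
Qed.

Lemma frob_ge0 (R : realFieldType) m n (M : 'M[R]_(m, n)) : 0 <= frob M.
Proof. by rewrite frobE; do 2!apply: sumr_ge0 => ? _; apply: sqr_ge0. Qed.

Lemma frob_entry (R : realFieldType) m n (M : 'M[R]_(m, n)) i j :
  M i j ^+ 2 <= frob M.
Proof.
rewrite frobE (bigD1 i)//= (bigD1 j)//= -addrA lerDl.
by apply: addr_ge0; do ?[apply: sumr_ge0 => ? _]; apply: sqr_ge0.
Qed.

Lemma frob_eq0 (R : realFieldType) m n (M : 'M[R]_(m, n)) :
  frob M <= 0 -> M = 0.
Proof.
move=> M0; apply/matrixP => i j; rewrite mxE; apply/eqP.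
by rewrite -sqrf_eq0 eq_le sqr_ge0 (le_trans (frob_entry M i j) M0).
Qed.

Lemma frob_tr (R : realFieldType) m n (M : 'M[R]_(m, n)) : frob M^T = frob M.
Proof. by rewrite /frob trmxK mxtrace_mulC. Qed.

Lemma frobBZ (R : realFieldType) m n (M N : 'M[R]_(m, n)) c :
  frob (M - c *: N) = frob M - 2 * c * \tr (M^T *m N) + c ^+ 2 * frob N.
Proof.
have NM : \tr (N^T *m M) = \tr (M^T *m N).
  by rewrite -mxtrace_tr trmx_mul trmxK.
have -> : frob (M - c *: N) = \tr ((M^T - c *: N^T) *m (M - c *: N)).
  by congr (\tr (_ *m _)); apply/matrixP => i j; rewrite !mxE.
rewrite mulmxBl !mulmxBr -!scalemxAl.
rewrite -!scalemxAr scalerA !raddfB /= !mxtraceZ NM /frob; ring.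
Qed.

(** Lagrange's identity: twice the defect is a sum of squares. *)
Lemma cauchy_schwarz_sum (R : realFieldType) (I : finType) (f g : I -> R) :
  (\sum_i f i * g i) ^+ 2 <= (\sum_i f i ^+ 2) * (\sum_i g i ^+ 2).
Proof.
have : 0 <= \sum_i \sum_j (f i * g j - f j * g i) ^+ 2.
  by do 2!apply: sumr_ge0 => ? _; apply: sqr_ge0.
have -> : \sum_i \sum_j (f i * g j - f j * g i) ^+ 2 =
    2 * ((\sum_i f i ^+ 2) * (\sum_i g i ^+ 2) - (\sum_i f i * g i) ^+ 2).
  rewrite mulrBr expr2 [in X in X - _]mulrDl !mul1r.
  rewrite {2}[(\sum_i f i ^+ 2) * _]mulrC !big_distrlr /=.
  rewrite mulr_sumr -big_split -sumrB; apply: eq_bigr => i _ /=.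
  by rewrite mulr_sumr -big_split -sumrB; apply: eq_bigr => j _ /=; ring.
by rewrite pmulr_rge0 ?ltr0n// subr_ge0.
Qed.

Lemma frobM (R : realFieldType) m n p (M : 'M[R]_(m, n)) (N : 'M[R]_(n, p)) :
  frob (M *m N) <= frob M * frob N.
Proof.
rewrite -(frob_tr N) !frobE big_distrlr /=; apply: ler_sum => i _.
apply: ler_sum => j _.
rewrite mxE (eq_bigr (fun k => M i k * N^T j k)) => [|k _]; last by rewrite !mxE.
exact: cauchy_schwarz_sum.
Qed.

Lemma frob_sandwich (R : realFieldType) m n p q (L : 'M[R]_(m, n))
    (X : 'M[R]_(n, p)) (N : 'M[R]_(p, q)) :
  frob (L *m X *m N) <= frob L * frob N * frob X.
Proof.
apply: le_trans (frobM _ _) _; rewrite mulrAC ler_wpM2r ?frob_ge0//.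
exact: frobM.
Qed.

(** Sampling a surface, E |-> A E B, and taking gradients, X |-> A^T X B^T, are
    adjoint for the trace inner product. *)
Lemma trace_adjoint (R : realFieldType) m n q p (A : 'M[R]_(m, n))
    (B : 'M[R]_(q, p)) (X : 'M[R]_(m, p)) (E : 'M[R]_(n, q)) :
  \tr (E^T *m (A^T *m X *m B^T)) = \tr (X^T *m (A *m E *m B)).
Proof.
rewrite -[LHS]mxtrace_tr !trmx_mul !trmxK -!mulmxA mxtrace_mulC.
by rewrite !mulmxA.
Qed.

(** The inverse of a bound on the squared operator norm of E |-> A E B. *)
Definition step_size (R : realFieldType) m n q p (A : 'M[R]_(m, n))
  (B : 'M[R]_(q, p)) : R := (frob A * frob B)^-1.

(** The cross term of the expanded square is twice what is claimed; the quadratic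
    term takes back at most half of it, by the choice of the step size. *)
Lemma residual_decrease (R : realFieldType) m n q p (A : 'M[R]_(m, n))
    (B : 'M[R]_(q, p)) (X : 'M[R]_(m, p)) :
  0 < frob A * frob B ->
  let G := A^T *m X *m B^T in
  frob (X - step_size A B *: (A *m G *m B))
    <= frob X - step_size A B * frob G.
Proof.
move=> w0 /=; set G := A^T *m X *m B^T.
have trG : \tr (X^T *m (A *m G *m B)) = frob G by rewrite -trace_adjoint.
rewrite frobBZ trG /step_size; have := frob_sandwich A G B.
move: (frob A * frob B) w0 (frob G) (frob (A *m G *m B)) => w w0 a b b_le.
have : w^-1 ^+ 2 * b <= w^-1 ^+ 2 * (w * a) by rewrite ler_wpM2l ?sqr_ge0.
have -> : w^-1 ^+ 2 * (w * a) = w^-1 * a by field; apply: lt0r_neq0.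
by lra.
Qed.

(** Effect of a gradient step on the difference to a least-squares solution. *)
Definition error_map (R : realFieldType) m n q p (A : 'M[R]_(m, n))
    (B : 'M[R]_(q, p)) (E : 'M[R]_(n, q)) : 'M[R]_(n, q) :=
  E - step_size A B *: (A^T *m (A *m E *m B) *m B^T).

Lemma error_map_linear (R : realFieldType) m n q p (A : 'M[R]_(m, n))
    (B : 'M[R]_(q, p)) :
  linear (error_map A B).
Proof.
move=> c E F; rewrite /error_map !(mulmxDr, mulmxDl) -!(scalemxAr, scalemxAl).
rewrite !scalerDr opprD addrACA scalerN; congr (_ - _ + _).
by rewrite !scalerA mulrC.
Qed.

(** This is [residual_decrease] for the adjoint pair. *)
Lemma error_map_decrease (R : realFieldType) m n q p (A : 'M[R]_(m, n))
    (B : 'M[R]_(q, p)) (E : 'M[R]_(n, q)) :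
  0 < frob A * frob B ->
  frob (error_map A B E) <= frob E - step_size A B * frob (A *m E *m B).
Proof.
move=> w0; have := @residual_decrease R _ _ _ _ A^T B^T E.
by rewrite /error_map /step_size !frob_tr !trmxK; apply.
Qed.

Lemma full_rank_frob_gt0 (R : realFieldType) m n (A : 'M[R]_(m, n.+1)) :
  \rank A = n.+1 -> 0 < frob A.
Proof. by case: (ltP 0 (frob A)) => // /frob_eq0 ->; rewrite mxrank0. Qed.

(** One-sided inverses L and N recover E from A E B, so that the decrease in
    [error_map_decrease] is at least a fixed fraction of the squared norm of E. *)
Lemma error_map_contraction (R : realFieldType) m n p (A : 'M[R]_(m, n.+1))
    (B : 'M[R]_(n.+1, p)) :
  \rank A = n.+1 -> \rank B^T = n.+1 ->
  exists2 r : R, 0 <= r < 1 & forall E, frob (error_map A B E) <= r * frob E.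
Proof.
move=> rA rB.
have w0 : 0 < frob A * frob B.
  by rewrite -(frob_tr B) mulr_gt0 ?full_rank_frob_gt0.
have /row_fullP[L LA] : row_full A by apply/eqP.
have /row_fullP[N NB] : row_full B^T by apply/eqP.
have BN : B *m N^T = 1%:M by rewrite -(trmxK B) -trmx_mul NB trmx1.
pose C := frob L * frob N^T.
have recover (E : 'M[R]_n.+1) : frob E <= C * frob (A *m E *m B).
  rewrite -[X in frob X <= _](_ : L *m (A *m E *m B) *m N^T = E).
    exact: frob_sandwich.
  by rewrite !mulmxA LA mul1mx -mulmxA BN mulmx1.
have one_gt0 : 0 < frob (1%:M : 'M[R]_n.+1).
  by rewrite full_rank_frob_gt0// mxrank1.
have C0 : 0 < C.
  rewrite lt_def mulr_ge0 ?frob_ge0// andbT; apply: contraTneq one_gt0 => C0.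
  by rewrite -leNgt (le_trans (recover _))// C0 mul0r.
have decr (E : 'M[R]_n.+1) :
    frob (error_map A B E) <= (1 - step_size A B / C) * frob E.
  apply: le_trans (error_map_decrease _ w0) _.
  rewrite mulrBl mul1r lerD2l lerN2 -mulrA ler_wpM2l ?invr_ge0 ?(ltW w0)//.
  by rewrite ler_pdivrMl.
exists (1 - step_size A B / C) => //; apply/andP; split.
  (* A negative ratio would contradict [decr] at the identity matrix. *)
  by rewrite -(pmulr_lge0 _ one_gt0) (le_trans _ (decr _))// frob_ge0.
by rewrite ltrBlDr ltrDl divr_gt0// invr_gt0.
Qed.

Lemma geometric_entry_cvg (R : realType) (m n : nat) (M : nat -> 'M[R]_(m, n))
    (r : R) i j :
  0 <= r < 1 -> (forall k, frob (M k.+1) <= r * frob (M k)) ->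
  M k i j @[k --> \oo] --> (0 : R).
Proof.
move=> /andP[r0 r1] Mr.
have frobr k : frob (M k) <= r ^+ k * frob (M 0%N).
  elim: k => [|k IHk]; first by rewrite expr0 mul1r.
  by rewrite (le_trans (Mr k))// exprS -mulrA ler_wpM2l.
have bound : Num.sqrt (r ^+ k * frob (M 0%N)) @[k --> \oo] --> (0 : R).
  rewrite -(@sqrtr0 R) -(mul0r (frob (M 0%N))).
  apply: continuous_cvg; first exact: sqrt_continuous.
  apply: (@cvgMr_tmp R _ _ _ (fun k => r ^+ k)).
  by apply: cvg_expr; rewrite ger0_norm.
apply/norm_cvg0P.
apply: (@squeeze_cvgr _ _ _ _ (cst 0) _ _ _ _ _ bound); last exact: cvg_cst.
apply: nearW => k /=; rewrite normr_ge0 -sqrtr_sqr ler_sqrt.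
  exact: le_trans (frob_entry _ _ _) (frobr k).
by rewrite mulr_ge0 ?exprn_ge0 ?frob_ge0.
Qed.

(** * Averages over finitely many random choices *)

(** Most recent choice first, so that [foldr] replays the choices in the order in
    which they were made. *)
Fixpoint history (V : Type) (c : nat -> V) (k : nat) : seq V :=
  if k is k'.+1 then c k' :: history c k' else [::].

Lemma size_history (V : Type) (c : nat -> V) k : size (history c k) == k.
Proof. by elim: k => //= k /eqP ->. Qed.

Lemma eq_history (V : Type) (c c' : nat -> V) k :
  history c k = history c' k <-> forall l, (l < k)%N -> c l = c' l.
Proof.
elim: k => [|k IHk]; first by [].
split=> [[ck /IHk ih] l|ih /=].
  by rewrite ltnS leq_eqVlt => /orP[/eqP ->//|/ih].
by rewrite ih//; congr cons; apply/IHk => l lk; apply: ih; apply: ltnW.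
Qed.

Lemma history_surj (V : Type) (v0 : V) (h : seq V) :
  exists c : nat -> V, history c (size h) = h.
Proof.
elim: h => [|v h [c ch]]; first by exists (fun=> v0).
exists (fun l => if l == size h then v else c l) => /=; rewrite eqxx -[in RHS]ch.
by congr cons; apply/eq_history => l lh; rewrite ltn_eqF.
Qed.

Lemma big_history (R : Type) (idx : R) (op : Monoid.com_law idx) (V : Type)
    (c : nat -> V) k (F : V -> R) :
  \big[op/idx]_(v <- history c k) F v = \big[op/idx]_(l <- iota 0 k) F (c l).
Proof.
elim: k => [|k IHk]; first by rewrite !big_nil.
by rewrite -addn1 iotaD big_cat big_seq1 addn1 big_cons IHk Monoid.mulmC.
Qed.

(** Expected value of [f] after k steps, when the moves are drawn independently
    with weights [pi]. *)
Definition path_mean (R : comPzRingType) (V : finType) (S : Type) (U : lmodType R)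
    (pi : V -> R) (step : V -> S -> S) (s0 : S) (k : nat) (f : S -> U) : U :=
  \sum_(h : k.-tuple V) (\prod_(v <- h) pi v) *: f (foldr step s0 h).

Lemma path_mean0 (R : comPzRingType) (V : finType) (S : Type) (U : lmodType R)
    (pi : V -> R) (step : V -> S -> S) (s0 : S) (f : S -> U) :
  path_mean pi step s0 0 f = f s0.
Proof.
rewrite /path_mean (big_pred1 [tuple]) => [|h]; last by rewrite (tuple0 h) /= eqxx.
by rewrite big_nil scale1r.
Qed.

(** Summing first over the last move: this plays the role of conditioning on
    the past. *)
Lemma path_meanS (R : comPzRingType) (V : finType) (S : Type) (U : lmodType R)
    (pi : V -> R) (step : V -> S -> S) (s0 : S) k (f : S -> U) :
  path_mean pi step s0 k.+1 f =
  path_mean pi step s0 k (fun s => \sum_v pi v *: f (step v s)).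
Proof.
pose cons_pair (vh : V * k.-tuple V) := [tuple of vh.1 :: vh.2].
rewrite /path_mean (reindex cons_pair) /=; last first.
  exists (fun h : k.+1.-tuple V => (thead h, [tuple of behead h])) => [[v h] _|h _].
    by rewrite /= theadE; congr pair; apply: val_inj.
  by rewrite /cons_pair /= -tuple_eta.
under [RHS]eq_bigr do rewrite scaler_sumr.
rewrite exchange_big pair_bigA; apply: eq_bigr => -[v h] _ /=.
by rewrite big_cons scalerA mulrC.
Qed.

Lemma path_mean_cst (R : comPzRingType) (V : finType) (S : Type)
    (U : lmodType R) (pi : V -> R) (step : V -> S -> S) (s0 : S) k (u : U) :
  \sum_v pi v = 1 -> path_mean pi step s0 k (fun=> u) = u.
Proof.
move=> pi1; elim: k => [|k IHk]; first exact: path_mean0.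
by rewrite path_meanS -scaler_suml pi1 scale1r.
Qed.

Lemma path_mean_linear (R : comPzRingType) (V : finType) (S : Type)
    (U W : lmodType R) (pi : V -> R) (step : V -> S -> S) (s0 : S) k
    (phi : U -> W) (f : S -> U) :
  linear phi ->
  path_mean pi step s0 k (fun s => phi (f s)) = phi (path_mean pi step s0 k f).
Proof.
move=> phiP; pose L : {linear U -> W} :=
  HB.pack phi (GRing.isLinear.Build _ _ _ _ phi phiP).
rewrite -[phi]/(L : U -> W) linear_sum.
by apply: eq_bigr => h _; rewrite linearZ.
Qed.

Lemma path_meanB (R : comPzRingType) (V : finType) (S : Type)
    (U : lmodType R) (pi : V -> R) (step : V -> S -> S) (s0 : S) k
    (f g : S -> U) :
  path_mean pi step s0 k (fun s => f s - g s) =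
  path_mean pi step s0 k f - path_mean pi step s0 k g.
Proof. by rewrite -sumrB; apply: eq_bigr => h _; rewrite scalerBr. Qed.

Lemma expectation_finite (d : measure_display) (T : measurableType d)
    (R : realType) (Pr : probability T R) (V : finType) (X : T -> V)
    (g : V -> R) :
  (forall v, measurable (X @^-1` [set v])) ->
  ('E_Pr[fun w => g (X w)] = \sum_v (g v)%:E * Pr (X @^-1` [set v]))%E.
Proof.
move=> mX; rewrite unlock.
transitivity (\int[Pr]_w \sum_v (g v)%:E * (\1_(X @^-1` [set v]) w)%:E)%E.
  apply: eq_integral => w _; rewrite (bigD1 (X w))//= indicE mem_set// mule1.
  rewrite big1 ?adde0// => v /eqP vX; rewrite indicE memNset ?mule0// => Xv.
  exact: vX.
have intX v : Pr.-integrable setT (fun w => (\1_(X @^-1` [set v]) w)%:E).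
  exact: integrable_indic.
rewrite integral_sum//; last by move=> v; exact: integrableZl.
by apply: eq_bigr => v _; rewrite integralZl// integral_indic// setIT.
Qed.

(** * The law of the block choices *)

Definition block_prob (R : realType) (n m a : nat) (mu : 'I_n.+1 -> R -> R)
    (x : 'I_m.+1 -> R) (I : 'I_a.+1 -> {set 'I_n.+1}) (s : 'I_a.+1) : R :=
  block_weight mu x (I s) / \sum_(i < n.+1) \sum_(h < m.+1) mu i (x h) ^+ 2.

Definition choice_prob (R : realType) (n m p a b : nat)
    (mu nu : 'I_n.+1 -> R -> R) (x : 'I_m.+1 -> R) (y : 'I_p.+1 -> R)
    (I : 'I_a.+1 -> {set 'I_n.+1}) (J : 'I_b.+1 -> {set 'I_n.+1})
    (v : 'I_a.+1 * 'I_b.+1) : R :=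
  block_prob mu x I v.1 * block_prob nu y J v.2.

(** Prescribing the choices of finitely many steps intersects independent events,
    one for each row choice and one for each column choice. *)
Lemma history_law (d : measure_display) (T : measurableType d)
  (R : realType) (Pr : probability T R) (n m p a b : nat)
  (mu nu : 'I_n.+1 -> R -> R) (x : 'I_m.+1 -> R) (y : 'I_p.+1 -> R)
  (I : 'I_a.+1 -> {set 'I_n.+1}) (J : 'I_b.+1 -> {set 'I_n.+1})
  (si : nat -> T -> 'I_a.+1) (sj : nat -> T -> 'I_b.+1) :
  rpia_choices Pr mu nu x y I J si sj ->
  forall h : seq ('I_a.+1 * 'I_b.+1),
  let H := [set w | history (fun l => (si l w, sj l w)) (size h) = h] in
  measurable H /\
  Pr H = (\prod_(v <- h) choice_prob mu nu x y I J v)%:E.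
Proof.
case=> mi mj indep lawi lawj h; have [c {2 3}<-] := history_surj (ord0, ord0) h.
move: (size h) => {h} k H.
(* The event [E z] fixes the single choice with index [z]. *)
pose E (z : nat + nat) : set T := match z with
  | inl l => si l @^-1` [set (c l).1] | inr l => sj l @^-1` [set (c l).2] end.
pose s := [seq inl l | l <- iota 0 k] ++ [seq inr l | l <- iota 0 k] : seq (nat + nat).
have HE : H = \bigcap_(z in [set` s]) E z.
  apply/seteqP; split=> w /=.
    move/eq_history => cw z /=; rewrite mem_cat.
    by case/orP=> /mapP[l + ->]; rewrite mem_iota => /andP[_ lk] /=; rewrite -cw.
  move=> Ew; apply/eq_history => l lk; rewrite [RHS]surjective_pairing.
  have ls : l \in iota 0 k by rewrite mem_iota.
  congr pair; [apply: (Ew (inl l)) | apply: (Ew (inr l))].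
    by rewrite /= mem_cat map_f.
  by rewrite /= mem_cat orbC map_f.
have evE z : (match z with inl l => events_of (si l) | inr l => events_of (sj l) end) (E z).
  by case: z => l; [exists [set (c l).1] | exists [set (c l).2]].
rewrite HE; split.
  apply: fin_bigcap_measurable => [|z _]; first exact: finite_seq.
  by case: z (evE z) => l; [exact: mi | exact: mj].
have s_uniq : uniq s.
  rewrite cat_uniq !map_inj_uniq ?iota_uniq; do ?by move=> ? ? [].
  by rewrite andbT; apply/hasPn => z /mapP[l _ ->]; apply/mapP => -[].
rewrite (indep s E s_uniq (fun z _ => evE z)).
rewrite big_cat !big_map big_history /=.
elim: (iota 0 k) => [|l r IHr]; first by rewrite !big_nil mule1.
by rewrite !big_cons muleACA IHr lawi lawj.
Qed.

Lemma block_partitionP (n a : nat) (I : 'I_a.+1 -> {set 'I_n.+1}) :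
  block_partition I ->
  exists blk : 'I_n.+1 -> 'I_a.+1, forall i s, (i \in I s) = (s == blk i).
Proof.
case=> _ disj cover.
have blk i : exists s, i \in I s.
  have : i \in (\bigcup_(s < a.+1) I s)%SET by rewrite cover finset.in_setT.
  by case/finset.bigcupP => s _ si; exists s.
have [f fP] := fin_all_exists blk; exists f => i s.
apply/idP/eqP => [si|-> //]; apply/eqP; apply: contraT => /disj /setP /(_ i).
by rewrite finset.in_setI finset.in_set0 si fP.
Qed.

Lemma total_weight (R : realType) (n m : nat) (mu : 'I_n.+1 -> R -> R)
    (x : 'I_m.+1 -> R) :
  \sum_(i < n.+1) \sum_(h < m.+1) mu i (x h) ^+ 2 = frob (collocation mu x).
Proof.
rewrite frobE exchange_big; apply: eq_bigr => h _.
by apply: eq_bigr => i _; rewrite mxE.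
Qed.

Lemma sum_block_prob (R : realType) (n m a : nat) (mu : 'I_n.+1 -> R -> R)
    (x : 'I_m.+1 -> R) (I : 'I_a.+1 -> {set 'I_n.+1}) :
  \rank (collocation mu x) = n.+1 -> block_partition I ->
  \sum_s block_prob mu x I s = 1.
Proof.
move=> /full_rank_frob_gt0; rewrite -total_weight => w0 /block_partitionP[blk blkP].
rewrite -mulr_suml /block_weight.
suff -> : \sum_s \sum_(i in I s) \sum_(h < m.+1) mu i (x h) ^+ 2 =
          \sum_(i < n.+1) \sum_(h < m.+1) mu i (x h) ^+ 2.
  by rewrite divff// lt0r_neq0.
rewrite [RHS](partition_big blk xpredT)//=; apply: eq_bigr => s _.
by apply: eq_bigl => i; rewrite blkP eq_sym.
Qed.

Lemma sum_choice_prob (R : realType) (n m p a b : nat)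
    (mu nu : 'I_n.+1 -> R -> R) (x : 'I_m.+1 -> R) (y : 'I_p.+1 -> R)
    (I : 'I_a.+1 -> {set 'I_n.+1}) (J : 'I_b.+1 -> {set 'I_n.+1}) :
  \rank (collocation mu x) = n.+1 -> \rank (collocation nu y) = n.+1 ->
  block_partition I -> block_partition J ->
  \sum_v choice_prob mu nu x y I J v = 1.
Proof.
move=> rkA rkB partI partJ.
rewrite -(pair_bigA _ (fun s r => block_prob mu x I s * block_prob nu y J r)).
by rewrite -big_distrlr /= !sum_block_prob// mulr1.
Qed.

(** A left inverse of the collocation matrix excludes zero columns, and no block
    is empty. *)
Lemma block_weight_gt0 (R : realType) (n m a : nat) (mu : 'I_n.+1 -> R -> R)
    (x : 'I_m.+1 -> R) (I : 'I_a.+1 -> {set 'I_n.+1}) (s : 'I_a.+1) :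
  \rank (collocation mu x) = n.+1 -> block_partition I ->
  0 < block_weight mu x (I s).
Proof.
move=> rk [/(_ s) /finset.set0Pn[i si] _ _].
have sq0 (k : 'I_n.+1) : 0 <= \sum_(h < m.+1) mu k (x h) ^+ 2.
  by apply: sumr_ge0 => h _; apply: sqr_ge0.
rewrite /block_weight (bigD1 i)//= ltr_wpDr ?sumr_ge0// lt_def sq0 andbT.
apply: contraTneq isT => /eqP; rewrite psumr_eq0 => [/allP mu0|h _]; last exact: sqr_ge0.
have /row_fullP[L /matrixP /(_ i i)] : row_full (collocation mu x) by apply/eqP.
rewrite !mxE eqxx big1 => [/eqP|h _]; first by rewrite eq_sym oner_eq0.
have /eqP := mu0 h (mem_index_enum _); rewrite mxE => /eqP.
by rewrite sqrf_eq0 => /eqP ->; rewrite mulr0.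
Qed.

(** * Fitting in matrix form *)

Definition coord_mx (R : realType) (m p : nat) (t : 'I_3)
    (P : 'I_m -> 'I_p -> 'rV[R]_3) : 'M[R]_(m, p) :=
  \matrix_(i, j) P i j ord0 t.

Lemma coord_residual (R : realType) (n m p : nat) (mu nu : 'I_n.+1 -> R -> R)
    (x : 'I_m.+1 -> R) (y : 'I_p.+1 -> R)
    (Q : 'I_m.+1 -> 'I_p.+1 -> 'rV[R]_3) (P : net R n) (t : 'I_3) :
  coord_mx t (residual mu nu x y Q P) =
  coord_mx t Q - collocation mu x *m coord_mx t P *m (collocation nu y)^T.
Proof.
apply/matrixP => h l; rewrite !mxE summxE; congr (_ - _).
under [RHS]eq_bigr do rewrite mxE mulr_suml.
rewrite exchange_big; apply: eq_bigr => i _; rewrite summxE.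
by apply: eq_bigr => j _; rewrite !mxE mulrAC.
Qed.

Lemma coord_gradient (R : realType) (n m p : nat) (mu nu : 'I_n.+1 -> R -> R)
    (x : 'I_m.+1 -> R) (y : 'I_p.+1 -> R)
    (F : 'I_m.+1 -> 'I_p.+1 -> 'rV[R]_3) (t : 'I_3) i j :
  (\sum_(h < m.+1) \sum_(l < p.+1) (mu i (x h) * nu j (y l)) *: F h l) ord0 t =
  ((collocation mu x)^T *m coord_mx t F *m collocation nu y) i j.
Proof.
rewrite summxE mxE; under [RHS]eq_bigr do rewrite mxE mulr_suml.
rewrite exchange_big; apply: eq_bigr => h _; rewrite summxE.
by apply: eq_bigr => l _; rewrite !mxE mulrAC.
Qed.

Lemma fitting_error_frob (R : realType) (n m p : nat)
    (mu nu : 'I_n.+1 -> R -> R) (x : 'I_m.+1 -> R) (y : 'I_p.+1 -> R)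
    (Q : 'I_m.+1 -> 'I_p.+1 -> 'rV[R]_3) (P : net R n) :
  fitting_error mu nu x y Q P = \sum_t frob (coord_mx t (residual mu nu x y Q P)).
Proof.
under [RHS]eq_bigr do rewrite frobE.
rewrite [RHS]exchange_big; apply: eq_bigr => h _; rewrite [RHS]exchange_big /=.
by apply: eq_bigr => l _; apply: eq_bigr => t _; rewrite [in RHS]mxE.
Qed.

(** A gradient step with the fixed step size lowers the error by a multiple of the
    squared norm of the gradient, which must therefore vanish at a minimum. *)
Lemma normal_equations (R : realType) (n m p : nat)
    (mu nu : 'I_n.+1 -> R -> R) (x : 'I_m.+1 -> R) (y : 'I_p.+1 -> R)
    (Q : 'I_m.+1 -> 'I_p.+1 -> 'rV[R]_3) (P : net R n) (t : 'I_3) :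
  0 < frob (collocation mu x) * frob (collocation nu y) ->
  least_squares mu nu x y Q P ->
  (collocation mu x)^T *m coord_mx t (residual mu nu x y Q P) *m collocation nu y = 0.
Proof.
set A := collocation mu x; set B := (collocation nu y)^T => w0.
have BT : B^T = collocation nu y by rewrite trmxK.
rewrite -BT -(frob_tr B^T) trmxK in w0 *.
pose c := step_size A B; have c0 : 0 < c by rewrite invr_gt0.
pose G u := A^T *m coord_mx u (residual mu nu x y Q P) *m B^T.
pose P' : net R n := fun i j => P i j + c *: \sum_(h < m.+1) \sum_(l < p.+1)
  (mu i (x h) * nu j (y l)) *: residual mu nu x y Q P h l.
have P'E u : coord_mx u P' = coord_mx u P + c *: G u.
  apply/matrixP => i j; rewrite [LHS]mxE [LHS]mxE [X in _ + X = _]mxE.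
  rewrite coord_gradient -BT.
  by rewrite [RHS]mxE [X in _ = X + _]mxE [X in _ = _ + X]mxE.
move=> /(_ P'); rewrite !fitting_error_frob => min.
have : \sum_u c * frob (G u) <= 0.
  rewrite -[X in _ <= X](subrr (\sum_u frob (coord_mx u (residual mu nu x y Q P)))).
  rewrite lerBrDl -lerBrDr (le_trans min)// -sumrB; apply: ler_sum => u _.
  rewrite coord_residual P'E mulmxDr mulmxDl opprD addrA -coord_residual.
  by rewrite -scalemxAr -scalemxAl; apply: residual_decrease.
rewrite -mulr_sumr pmulr_rle0// => G0; apply: frob_eq0; apply: le_trans G0.
by rewrite (bigD1 t)//= lerDl sumr_ge0// => u _; apply: frob_ge0.
Qed.

(** * The mean of an RPIA step *)

Definition rpia_step (R : realType) (n m p a b : nat)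
    (mu nu : 'I_n.+1 -> R -> R) (x : 'I_m.+1 -> R) (y : 'I_p.+1 -> R)
    (Q : 'I_m.+1 -> 'I_p.+1 -> 'rV[R]_3)
    (I : 'I_a.+1 -> {set 'I_n.+1}) (J : 'I_b.+1 -> {set 'I_n.+1})
    (v : 'I_a.+1 * 'I_b.+1) (P : net R n) : net R n :=
  fun i j => P i j + adjustment mu nu x y Q (I v.1) (J v.2) P i j.

Lemma rpia_foldr (R : realType) (n m p a b : nat)
    (mu nu : 'I_n.+1 -> R -> R) (x : 'I_m.+1 -> R) (y : 'I_p.+1 -> R)
    (Q : 'I_m.+1 -> 'I_p.+1 -> 'rV[R]_3)
    (I : 'I_a.+1 -> {set 'I_n.+1}) (J : 'I_b.+1 -> {set 'I_n.+1})
    (P0 : net R n) si sj k :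
  rpia mu nu x y Q I J P0 si sj k =
  foldr (rpia_step mu nu x y Q I J) P0 (history (fun l => (si l, sj l)) k).
Proof. by elim: k => //= k ->. Qed.

(** The probability of a block pair and the normalisation of the adjustment on it
    multiply to a constant that depends on neither the pair nor the partition. *)
Lemma mean_step (R : realType) (n m p a b : nat)
    (mu nu : 'I_n.+1 -> R -> R) (x : 'I_m.+1 -> R) (y : 'I_p.+1 -> R)
    (Q : 'I_m.+1 -> 'I_p.+1 -> 'rV[R]_3)
    (I : 'I_a.+1 -> {set 'I_n.+1}) (J : 'I_b.+1 -> {set 'I_n.+1})
    (P : net R n) (t : 'I_3) :
  \rank (collocation mu x) = n.+1 -> \rank (collocation nu y) = n.+1 ->
  block_partition I -> block_partition J ->
  \sum_v choice_prob mu nu x y I J v *: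
      coord_mx t (rpia_step mu nu x y Q I J v P) =
  coord_mx t P + (frob (collocation mu x) * frob (collocation nu y))^-1 *:
    ((collocation mu x)^T *m coord_mx t (residual mu nu x y Q P) *m collocation nu y).
Proof.
move=> rkA rkB partI partJ; apply/matrixP => i j.
rewrite summxE [RHS]mxE [in X in _ = _ + X]mxE.
under eq_bigr do rewrite !mxE mulrDr.
rewrite big_split -mulr_suml /=; congr (_ + _).
  by rewrite sum_choice_prob// mul1r mxE.
have [f fP] := block_partitionP partI; have [g gP] := block_partitionP partJ.
(* Only the block pair that contains (i, j) moves that entry. *)
rewrite (bigD1 (f i, g j))//= [X in _ + X]big1 ?addr0 => [|[s r] sr]; last first.
  by rewrite /adjustment fP gP -xpair_eqE (negbTE sr) mxE mulr0.
rewrite /adjustment fP gP !eqxx /= mxE coord_gradient mulrA; congr (_ * _).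
rewrite /choice_prob /block_prob !total_weight invfM.
by field; rewrite !lt0r_neq0// ?block_weight_gt0// full_rank_frob_gt0.
Qed.

Lemma rpia_expectation (R : realType) (n m p a b : nat)
  (mu nu : 'I_n.+1 -> R -> R) (x : 'I_m.+1 -> R) (y : 'I_p.+1 -> R)
  (Q : 'I_m.+1 -> 'I_p.+1 -> 'rV[R]_3)
  (I : 'I_a.+1 -> {set 'I_n.+1}) (J : 'I_b.+1 -> {set 'I_n.+1})
  (P0 : net R n)
  (d : measure_display) (T : measurableType d) (Pr : probability T R)
  (si : nat -> T -> 'I_a.+1) (sj : nat -> T -> 'I_b.+1) k (f : net R n -> R) :
  rpia_choices Pr mu nu x y I J si sj ->
  ('E_Pr[fun w =>
     f (rpia mu nu x y Q I J P0 (fun l => si l w) (fun l => sj l w) k)] =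
   (path_mean (choice_prob mu nu x y I J)
     (rpia_step mu nu x y Q I J) P0 k (f : net R n -> R^o))%:E)%E.
Proof.
move=> /history_law law.
pose X w := Tuple (size_history (fun l => (si l w, sj l w)) k).
pose g (h : k.-tuple ('I_a.+1 * 'I_b.+1)) := f (foldr (rpia_step mu nu x y Q I J) P0 h).
have XE h : X @^-1` [set h] =
    [set w | history (fun l => (si l w, sj l w)) (size h) = h].
  rewrite size_tuple; apply/seteqP; split=> w /= [Xw]; first by rewrite -Xw.
  by apply: val_inj.
have -> : (fun w => f (rpia mu nu x y Q I J P0 (fun l => si l w) (fun l => sj l w) k))
    = (fun w => g (X w)).
  by apply/funext => w; rewrite rpia_foldr.
rewrite expectation_finite => [|h]; last by rewrite XE; case: (law h).
rewrite /path_mean -sumEFin; apply: eq_bigr => h _.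
by rewrite XE (law h).2 -EFinM mulrC.
Qed.

Lemma mean_error_recursion (R : realType) (n m p a b : nat)
    (mu nu : 'I_n.+1 -> R -> R) (x : 'I_m.+1 -> R) (y : 'I_p.+1 -> R)
    (Q : 'I_m.+1 -> 'I_p.+1 -> 'rV[R]_3)
    (I : 'I_a.+1 -> {set 'I_n.+1}) (J : 'I_b.+1 -> {set 'I_n.+1})
    (P0 Pstar : net R n) (t : 'I_3) k :
  \rank (collocation mu x) = n.+1 -> \rank (collocation nu y) = n.+1 ->
  block_partition I -> block_partition J ->
  least_squares mu nu x y Q Pstar ->
  let error k := path_mean (choice_prob mu nu x y I J)
    (rpia_step mu nu x y Q I J) P0 k
    (fun P => coord_mx t P - coord_mx t Pstar) in
  error k.+1 = error_map (collocation mu x) (collocation nu y)^T (error k).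
Proof.
move=> rkA rkB partI partJ lsq error; rewrite /error path_meanS.
rewrite -path_mean_linear; last exact: error_map_linear.
congr path_mean; apply/funext => P; under eq_bigr do rewrite scalerBr.
rewrite sumrB mean_step// -scaler_suml sum_choice_prob// scale1r.
rewrite /error_map addrAC -scalerN /step_size frob_tr.
congr (_ + _ *: _).
have w0 := mulr_gt0 (full_rank_frob_gt0 rkA) (full_rank_frob_gt0 rkB).
have := @normal_equations _ _ _ _ mu nu x y Q Pstar t w0 lsq.
rewrite !coord_residual trmxK; set A := collocation mu x => neq.
(* Subtracting the vanishing gradient at [Pstar] removes the data. *)
rewrite -[LHS]subr0 -neq -mulmxBl -mulmxBr -[RHS]mulNmx; congr (_ *m _).
rewrite -[RHS]mulmxN; congr (_ *m _).
by rewrite mulmxBr mulmxBl !opprB addrC addrA subrK.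
Qed.

(** * Convergence *)

Lemma rpia_mean_cvg (R : realType) (n m p a b : nat)
    (mu nu : 'I_n.+1 -> R -> R) (x : 'I_m.+1 -> R) (y : 'I_p.+1 -> R)
    (Q : 'I_m.+1 -> 'I_p.+1 -> 'rV[R]_3)
    (I : 'I_a.+1 -> {set 'I_n.+1}) (J : 'I_b.+1 -> {set 'I_n.+1})
    (P0 Pstar : net R n) (t : 'I_3) i j :
  \rank (collocation mu x) = n.+1 -> \rank (collocation nu y) = n.+1 ->
  block_partition I -> block_partition J ->
  least_squares mu nu x y Q Pstar ->
  path_mean (choice_prob mu nu x y I J) (rpia_step mu nu x y Q I J) P0 k
    (fun P => P i j ord0 t : R^o) @[k --> \oo] --> Pstar i j ord0 t.
Proof.
move=> rkA rkB partI partJ lsq.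
pose error k := path_mean (choice_prob mu nu x y I J)
  (rpia_step mu nu x y Q I J) P0 k
  (fun P => coord_mx t P - coord_mx t Pstar).
have -> : (fun k => path_mean (choice_prob mu nu x y I J)
      (rpia_step mu nu x y Q I J) P0 k (fun P => P i j ord0 t : R^o)) =
    (fun k => error k i j + Pstar i j ord0 t).
  apply/funext => k; rewrite /error path_meanB path_mean_cst ?sum_choice_prob//.
  by rewrite !mxE subrK summxE; apply: eq_bigr => h _; rewrite !mxE.
rewrite -[X in _ --> X]add0r; apply: cvgD; last exact: cvg_cst.
have [|r r01 contr] := @error_map_contraction _ _ _ _ _ (collocation nu y)^T rkA.
  by rewrite trmxK.
by apply: geometric_entry_cvg r01 _ => k; rewrite /error mean_error_recursion.
Qed.

Theorem theorem4p2 (R : realType) (n m p a b : nat)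
  (mu nu : 'I_n.+1 -> R -> R)
  (x : 'I_m.+1 -> R) (y : 'I_p.+1 -> R)
  (x01 : forall h, 0 <= x h <= 1) (y01 : forall l, 0 <= y l <= 1)
  (x_incr : forall h h' : 'I_m.+1, (h < h')%N -> x h < x h')
  (y_incr : forall l l' : 'I_p.+1, (l < l')%N -> y l < y l')
  (A : 'M[R]_(m.+1, n.+1)) (B : 'M[R]_(n.+1, p.+1))
  (defA : A = collocation mu x) (defB : B^T = collocation nu y)
  (rankA : \rank A = n.+1) (rankB : \rank B^T = n.+1)
  (many_data : (n.+1 ^ 2 < m.+1 * p.+1)%N)
  (Q : 'I_m.+1 -> 'I_p.+1 -> 'rV[R]_3)
  (I : 'I_a.+1 -> {set 'I_n.+1}) (J : 'I_b.+1 -> {set 'I_n.+1})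
  (partI : block_partition I) (partJ : block_partition J)
  (P0 : net R n)
  (d : measure_display) (T : measurableType d) (Pr : probability T R)
  (si : nat -> T -> 'I_a.+1) (sj : nat -> T -> 'I_b.+1)
  (choices : rpia_choices Pr mu nu x y I J si sj)
  (Pk : nat -> T -> net R n)
  (defPk : forall k w,
     Pk k w = rpia mu nu x y Q I J P0 (fun k' => si k' w) (fun k' => sj k' w) k)
  (Pstar : net R n) (lsq : least_squares mu nu x y Q Pstar) :
  (forall (i j : 'I_n.+1) (t : 'I_3),
     'E_Pr[fun w => Pk k w i j ord0 t]%E @[k --> \oo]
       --> (Pstar i j ord0 t)%:E)
  /\
  (forall (u v : R) (t : 'I_3),
     x ord0 <= u <= x ord_max -> y ord0 <= v <= y ord_max ->
     'E_Pr[fun w => surface mu nu (Pk k w) u v ord0 t]%E @[k --> \oo]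
       --> (surface mu nu Pstar u v ord0 t)%:E).
Proof.
rewrite defA in rankA; rewrite defB in rankB.
pose mean k (f : net R n -> R) :=
  path_mean (choice_prob mu nu x y I J) (rpia_step mu nu x y Q I J) P0 k (f : net R n -> R^o).
have meanE (f : net R n -> R) :
    (fun k => 'E_Pr[fun w => f (Pk k w)]%E) = (fun k => (mean k f)%:E).
  apply/funext => k; rewrite -(rpia_expectation _ _ _ _ choices).
  by congr expectation; apply/funext => w; rewrite defPk.
have mean_cvg i j t : mean k (fun P => P i j ord0 t) @[k --> \oo] --> Pstar i j ord0 t.
  exact: rpia_mean_cvg.
split=> [i j t|u v t _ _].
  rewrite (meanE (fun P => P i j ord0 t)).
  by apply: cvg_EFin; [exact: nearW | exact: mean_cvg].
pose S (P : net R n) := \sum_(i < n.+1) \sum_(j < n.+1) mu i u * nu j v * P i j ord0 t.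
have SE P : surface mu nu P u v ord0 t = S P.
  rewrite summxE; apply: eq_bigr => i _; rewrite summxE.
  by apply: eq_bigr => j _; rewrite mxE.
rewrite (meanE (fun P => surface mu nu P u v ord0 t)) SE.
have -> : (fun k => (mean k (fun P => surface mu nu P u v ord0 t))%:E) =
    (fun k => (\sum_(i < n.+1) \sum_(j < n.+1)
       mu i u * nu j v * mean k (fun P => P i j ord0 t))%:E).
  apply/funext => k; congr (_%:E); rewrite /mean /path_mean.
  under eq_bigr do rewrite SE scaler_sumr.
  rewrite exchange_big; apply: eq_bigr => i _ /=.
  under eq_bigr do rewrite scaler_sumr.
  rewrite exchange_big; apply: eq_bigr => j _ /=; rewrite mulr_sumr.
  by apply: eq_bigr => h _; rewrite /GRing.scale /= mulrCA.
apply: cvg_EFin; first exact: nearW.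
apply: cvg_big => [|i _]; first exact: add_continuous.
apply: cvg_big => [|j _]; first exact: add_continuous.
exact: cvgMl_tmp (mean_cvg i j t).
Qed.
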